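(* For every integer $n \ge 1$ with $n \neq 5$, $$\mathrm{ex}(n,F_{3,3}) = b(n), \qquad \text{where } b(n) = \binom{n}{3} - \binom{\lfloor n/2 \rfloor}{3} - \binom{\lceil n/2 \rceil}{3},$$ and for $n=5$ one has $\mathrm{ex}(5,F_{3,3}) = 10$.
   Context: A $3$-graph (3-uniform hypergraph) $G$ consists of a finite vertex set and an edge set, each edge being a $3$-element subset of the vertex set. For a $3$-graph $F$, a $3$-graph $G$ is called $F$-free if it has no (not necessarily induced) subgraph isomorphic to $F$. The Turán number $\mathrm{ex}(n,F)$ is the maximum number of edges in an $F$-free $3$-graph on $n$ vertices. $F_{3,3}$ denotes the $3$-graph on $6$ vertices $a,b,c,x,y,z$ with exactly $10$ edges: the edge $\{a,b,c\}$, together with the $9$ triples that contain exactly one vertex from $\{a,b,c\}$ and exactly two vertices from $\{x,y,z\}$. Binomial coefficients $\binom{k}{3}$ are $0$ for integers $0 \le k < 3$. *)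

(* Defs.v *)
From mathcomp Require Import all_boot.

Set Implicit Arguments.
Unset Strict Implicit.
Unset Printing Implicit Defensive.

(* A 3-graph on the vertex set T is given by its edge set E : {set {set T}}. *)
Definition is_3graph (T : finType) (E : {set {set T}}) : bool :=
  [forall e in E, #|e| == 3].

(* Not necessarily induced copies: injective on vertices, edges to edges. *)
Definition contains_copy (S T : finType)
    (F : {set {set S}}) (G : {set {set T}}) : bool :=
  [exists f : {ffun S -> T}, injectiveb f && [forall e in F, f @: e \in G]].

Definition free (S T : finType)
    (F : {set {set S}}) (G : {set {set T}}) : bool :=
  ~~ contains_copy F G.

(* An empty \max is 0; this does not occur when F has an edge, since the
   3-graph without edges is then F-free. *)
Definition ex (n : nat) (S : finType) (F : {set {set S}}) : nat :=
  \max_(G : {set {set 'I_n}} | is_3graph G && free F G) #|G|.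

(* The vertices a, b, c are the inl i and x, y, z are the inr i. *)
Definition abc : {set 'I_3 + 'I_3} := [set inl i | i : 'I_3].
Definition xyz : {set 'I_3 + 'I_3} := [set inr i | i : 'I_3].

Definition F33 : {set {set 'I_3 + 'I_3}} :=
  abc |: [set e : {set 'I_3 + 'I_3} |
            (#|e :&: abc| == 1) && (#|e :&: xyz| == 2)].

(* The truncated subtractions are exact: n./2 + uphalf n = n, so the two
   subtracted terms count disjoint families of triples out of n points. *)
Definition b (n : nat) : nat :=
  'C(n, 3) - 'C(n./2, 3) - 'C(uphalf n, 3).

(* Main.v *)
(* Upper bound, by induction on the number n of vertices; K_k is the complete
   3-graph on k vertices.
   - Without K_4 and for n >= 4, averaging over 4-sets bounds the number of edges by
     3/4 * C(n, 3) <= b(n).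
   - With a K_4 on S but no K_5, weight a pair xy outside S by the number of s in
     S such that sxy is an edge.  F_{3,3}-freeness makes the weight of every
     triangle at most 10, so that m = n - 4 points carry total weight at most
     3 * C(m, 2) + m/2.  Every outside vertex spans at most 5 edges with two points
     of S, as otherwise there would be a K_5, and 4 + 5m + 3 * C(m, 2) + m/2
     is exactly b(n) - b(n - 4).
   - With a K_5 on S, the weight bound is averaged over the five 4-subsets of S,
     and every outside vertex spans at most 7 edges with two points of S.
   The second step only recurses on 3-graphs without K_5, which keeps the
   exceptional value at n = 5 from propagating to n = 9.
   The lower bound is the 3-graph of all triples that meet both halves of the
   vertex set. *)
Require Import Defs.
From mathcomp Require Import all_boot.
From mathcomp Require Import zify.

Set Implicit Arguments.
Unset Strict Implicit.

(** * Arithmetic of b *)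

Lemma bin3_mul6 n : 6 * 'C(n, 3) = n * (n - 1) * (n - 2).
Proof. by rewrite -[6]/(3`!) mulnC bin_ffact !ffactnS ffactn0 muln1 mulnA -!subn1 -subnDA. Qed.

(** Once the parity of the argument is fixed, [b] is a polynomial in [k]. Multiplying by 6 turns the
    binomials into products, and splitting off small [k] makes the truncated subtractions exact. *)
Lemma b_double k : b k.*2 = k * k * (k - 1).
Proof.
suff: 6 * b k.*2 = 6 * (k * k * (k - 1)) by lia.
rewrite /b uphalf_double doubleK !mulnBr !bin3_mul6.
case: k => [|[|k]] //; rewrite !doubleS !(subn1, subn2) /= -mul2n.
lia.
Qed.

(** The factor 2 keeps the odd case free of division. *)
Lemma b_doubleS k : 2 * b k.*2.+1 = k * (2 * k - 1) * (k + 1).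
Proof.
suff: 6 * b k.*2.+1 = 3 * (k * (2 * k - 1) * (k + 1)) by lia.
rewrite /b uphalfE -doubleS doubleK -[k.*2.+1./2]/(uphalf k.*2) uphalf_double.
rewrite !mulnBr !bin3_mul6.
case: k => [|[|k]] //; rewrite !doubleS mul2n !doubleS !(subn1, subn2) /= -mul2n.
lia.
Qed.

Lemma b_ge_three_quarters n : 3 < n -> 3 * (n * (n - 1) * (n - 2)) <= 24 * b n.
Proof.
rewrite -[n]odd_double_half; move: n./2 => k; case: (odd n); rewrite ?add1n ?add0n => n3.
  have := b_doubleS k; case: k n3 => [|k] // _.
  rewrite mul2n !doubleS !(subn1, subn2) /= -mul2n.
  lia.
rewrite b_double; case: k n3 => [|k] // _.
rewrite !doubleS !(subn1, subn2) /= -mul2n.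
lia.
Qed.

(** Six times the identity 4 + 5m + 3 * C(m, 2) + m/2 = b(m + 4) - b(m), grouped like the blocks of
    [sum3_cat] so that it fits counts of ordered triples. *)
Lemma b_add4 m :
  24 + 30 * m + 3 * (3 * (m * (m - 1)) + 2 * m./2) + 6 * b m = 6 * b (m + 4).
Proof.
rewrite -[m]odd_double_half; move: m./2 => k; case: (odd m); rewrite ?add1n ?add0n.
  have -> : k.*2.+1 + 4 = k.+2.*2.+1 by lia.
  have := b_doubleS k; have := b_doubleS k.+2.
  have -> : k.*2.+1./2 = k by lia.
  case: k => [|k] //; rewrite !mul2n !doubleS !(subn1, subn2) /= -!mul2n.
  lia.
have -> : k.*2 + 4 = k.+2.*2 by lia.
rewrite !b_double doubleK; case: k => [|k] //.
rewrite !doubleS !(subn1, subn2) /= -!mul2n.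
lia.
Qed.

(** Counts of ordered triples times 4, because the weight bound is averaged over five 4-subsets. For
    m = 0 both sides are equal, with the exceptional term on the right; for m = 5 the slack absorbs
    the exceptional term on the left. *)
Lemma b_add5_ge m :
  240 + 168 * m + 15 * (3 * (m * (m - 1)) + 2 * m./2)
    + 4 * (6 * b m + 6 * (m == 5)) <= 4 * (6 * b (m + 5) + 6 * (m + 5 == 5)).
Proof.
have [->|m0] := posnP m; first by rewrite /b.
have -> : (m + 5 == 5) = false by lia.
(* All that is kept of the exceptional term is that it is at most 1, and 0 for even [m]; then the
   parity cases are polynomial inequalities. *)
have : (m == 5) <= 1 by case: eqP.
have : ~~ odd m -> (m == 5) = 0 :> nat by lia.
move: (nat_of_bool (m == 5)) => t.
move: m0; rewrite -[m]odd_double_half; move: m./2 => k; case: (odd m); rewrite ?add1n ?add0n /=.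
  move=> _ _ t1.
  have -> : k.*2.+1 + 5 = k.+3.*2 by lia.
  have := b_doubleS k; rewrite b_double uphalf_double.
  case: k => [_|k]; first by case: t t1 => [|[|t]].
  rewrite ?mul2n ?doubleS !(subn1, subn2) /= -!mul2n.
  lia.
rewrite odd_double => k0 /(_ isT) -> _.
have -> : k.*2 + 5 = k.+2.*2.+1 by lia.
rewrite !b_double doubleK; have := b_doubleS k.+2; case: k k0 => [|k] // _.
rewrite ?mul2n ?doubleS !(subn1, subn2) /= -!mul2n.
lia.
Qed.

(** * Weighted pairs and triples *)

Section TripleSums.
Variable T : eqType.
Implicit Types (r s : seq T) (w : T -> T -> nat) (f : T -> T -> T -> nat).

(* For a symmetric f vanishing on repeated arguments these sums count every
   pair twice and every triple six times. *)
Definition sum2 w r := \sum_(x <- r) \sum_(y <- r) w x y.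
Definition sum3 f r1 r2 r3 :=
  \sum_(x <- r1) \sum_(y <- r2) \sum_(z <- r3) f x y z.

Lemma leq_sum_size (F : T -> nat) r c :
  {in r, forall x, F x <= c} -> \sum_(x <- r) F x <= c * size r.
Proof.
move=> Fc; rewrite big_seq; apply: leq_trans (leq_sum _ Fc) _.
by rewrite -big_seq big_const_seq count_predT iter_addn_0.
Qed.

Lemma perm_sum3 f r1 r2 :
  perm_eq r1 r2 -> sum3 f r1 r1 r1 = sum3 f r2 r2 r2.
Proof.
move=> eq_r; rewrite /sum3 (perm_big _ eq_r); apply: eq_bigr => x _.
rewrite (perm_big _ eq_r); apply: eq_bigr => y _.
exact: perm_big.
Qed.

(** The sum splits into eight blocks, and by symmetry a block depends only on how many of its three
    arguments range over [r]. *)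
Lemma sum3_cat f r s :
    (forall x y z, f x y z = f y x z) -> (forall x y z, f x y z = f x z y) ->
  sum3 f (s ++ r) (s ++ r) (s ++ r) =
  sum3 f s s s + 3 * sum3 f r s s + 3 * sum3 f s r r + sum3 f r r r.
Proof.
move=> fC fAC.
have swap12 r1 r2 r3 : sum3 f r1 r2 r3 = sum3 f r2 r1 r3.
  rewrite /sum3 exchange_big; apply: eq_bigr => x _; apply: eq_bigr => y _.
  by apply: eq_bigr.
have swap23 r1 r2 r3 : sum3 f r1 r2 r3 = sum3 f r1 r3 r2.
  apply: eq_bigr => x _; rewrite exchange_big.
  by apply: eq_bigr => y _; apply: eq_bigr.
have cat1 r1 r2 : sum3 f (s ++ r) r1 r2 = sum3 f s r1 r2 + sum3 f r r1 r2.
  exact: big_cat.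
have cat2 r1 r2 : sum3 f r1 (s ++ r) r2 = sum3 f r1 s r2 + sum3 f r1 r r2.
  by rewrite !(swap12 r1) cat1.
have cat3 r1 r2 : sum3 f r1 r2 (s ++ r) = sum3 f r1 r2 s + sum3 f r1 r2 r.
  by rewrite !(swap23 r1 r2) cat2.
rewrite cat1 !cat2 !cat3 (swap23 s s r) (swap12 s r s) (swap23 r r s).
rewrite (swap12 r s r); lia.
Qed.

(** With the first argument summed innermost, the inner sum is the weight of a pair, and [sum2_le]
    becomes applicable. *)
Lemma sum3E f r1 r2 r3 :
  sum3 f r1 r2 r3 = \sum_(y <- r2) \sum_(z <- r3) \sum_(x <- r1) f x y z.
Proof.
by rewrite /sum3 exchange_big; apply: eq_bigr => y _; rewrite exchange_big.
Qed.

Lemma sum2_cons w x r : (forall x y, w x y = w y x) ->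
  sum2 w (x :: r) = w x x + 2 * \sum_(y <- r) w x y + sum2 w r.
Proof.
move=> wC; rewrite /sum2 !big_cons.
under [X in _ + X]eq_bigr do rewrite big_cons wC.
by rewrite big_split /=; lia.
Qed.

Lemma sum2_le3 w r :
    (forall x y, w x y = w y x) -> (forall x, w x x = 0) ->
  {in r &, forall x y, w x y <= 3} -> sum2 w r <= 3 * (size r * (size r - 1)).
Proof.
move=> wC w0; elim: r => [|x r IH] w3; first by rewrite /sum2 big_nil.
have {}IH : sum2 w r <= 3 * (size r * (size r - 1)).
  by apply: IH => y z yr zr; apply: w3; rewrite inE (yr, zr) orbT.
have : \sum_(y <- r) w x y <= 3 * size r.
  by apply: leq_sum_size => y yr; apply: w3; rewrite inE ?eqxx ?yr ?orbT.
rewrite sum2_cons // w0 /=.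
case: (size r) IH => [|n]; rewrite !subn1 /=; lia.
Qed.

(* A pair of weight 4 can be removed: every further vertex sends at most 6 to it. *)
Lemma sum2_le w r :
    (forall x y, w x y = w y x) -> (forall x, w x x = 0) ->
    (forall x y, w x y <= 4) ->
    (forall x y z, w x y + w x z + w y z <= 10) ->
  sum2 w r <= 3 * (size r * (size r - 1)) + 2 * (size r)./2.
Proof.
move=> wC w0 w4 w10; have [n] := ubnP (size r); elim: n r => // n IH r lt_r.
case: (boolP (has (fun x => has (fun y => 3 < w x y) r) r)); last first.
  move=> /hasPn r3; apply: leq_trans (leq_addr _ _); apply: sum2_le3 => // x y xr yr.
  by have /hasPn/(_ y yr) := r3 x xr; rewrite -leqNgt.
case/hasP => x xr /hasP[y yr wxy].
have yx : y \in rem x r.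
  move: yr; rewrite (perm_mem (perm_to_rem xr)) inE => /predU1P[yx|//].
  by rewrite yx w0 in wxy.
have eq_r : perm_eq r [:: x, y & rem y (rem x r)].
  by rewrite (permPl (perm_to_rem xr)) perm_cons perm_to_rem.
move: (rem y _) eq_r => r' eq_r.
have -> : sum2 w r = sum2 w [:: x, y & r'].
  by rewrite /sum2 (perm_big _ eq_r); apply: eq_bigr => z _; apply: perm_big.
have szr : size r = (size r').+2 by rewrite (perm_size eq_r).
have {}IH := IH r' ltac:(lia).
have : \sum_(z <- r') (w x z + w y z) <= 6 * size r'.
  by apply: leq_sum_size => z _; have := w10 x y z; lia.
(* The removed pair contributes at most 2 * (4 + 6 * size r'), which is exactly the growth of the
   bound from [size r'] to [size r' + 2]. *)
rewrite big_split /= !sum2_cons // !w0 big_cons szr.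
have := w4 x y; case: (size r') IH => [|m]; rewrite !subn1 /=; lia.
Qed.

(** The factor [uniq s] makes the count iterable: summing out one variable leaves a sum of the same
    shape in the next. *)
Lemma sum_uniq_cons r s k : size s = k -> uniq r -> {subset s <= r} ->
  \sum_(x <- r) uniq (x :: s) = (size r - k) * uniq s.
Proof.
move=> <- Ur s_r /=; case Us: (uniq s); last first.
  by rewrite muln0 big1 // => x _; rewrite andbF.
under eq_bigr do rewrite andbT.
have -> : \sum_(x <- r) (x \notin s) = count (predC (mem s)) r.
  by rewrite -sum1_count [RHS]big_mkcond; apply: eq_bigr => x _ /=; case: (_ \notin _).
rewrite muln1 -(count_predC (mem s) r) -(size_filter (mem s)).
suff /perm_size -> : perm_eq (filter (mem s) r) s by rewrite addKn.
apply: uniq_perm => //; first exact: filter_uniq.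
by move=> x; rewrite mem_filter /= andb_idr //; apply: s_r.
Qed.

Lemma sum3_uniq r : uniq r ->
  sum3 (fun x y z => uniq [:: z; y; x]) r r r =
  size r * (size r - 1) * (size r - 2).
Proof.
move=> Ur; rewrite /sum3.
under eq_big_seq => x xr.
  under eq_big_seq => y yr.
    rewrite (@sum_uniq_cons r [:: y; x] 2) //; last by apply/allP; rewrite /= yr xr.
    over.
  rewrite -big_distrr /= (@sum_uniq_cons r [:: x] 1) //; last by apply/allP; rewrite /= xr.
  over.
rewrite /= big_const_seq count_predT iter_addn_0; lia.
Qed.

End TripleSums.

(** * Cliques and the upper bound *)

Section CliqueFree.
Variables (T : eqType) (h : T -> T -> T -> bool).
Hypothesis hC : forall x y z, h x y z = h y x z.
Hypothesis hAC : forall x y z, h x y z = h x z y.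
Hypothesis hxx : forall x y, h x x y = false.
Implicit Types (r s : seq T).

(** The 3-graph is a symmetric relation [h] and vertex sets are duplicate-free sequences, so passing
    to an induced subgraph changes neither the type nor [h]. *)
Definition clique s :=
  all (fun x => all (fun y => all (fun z => uniq [:: x; y; z] ==> h x y z) s) s) s.

Lemma cliqueP s :
  reflect {in s & &, forall x y z, uniq [:: x; y; z] -> h x y z} (clique s).
Proof.
apply: (iffP allP) => [cs x y z xs ys zs|cs x xs].
  by have /allP/(_ y ys)/allP/(_ z zs)/implyP := cs x xs.
by apply/allP=> y ys; apply/allP=> z zs; apply/implyP; apply: cs.
Qed.

Lemma clique_cons x s : clique s ->
  {in s &, forall y z, y != z -> h x y z} -> clique (x :: s).
Proof.
move=> /cliqueP cs hx; apply/cliqueP => u v t.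
rewrite /= !inE negb_or andbT.
(* Of the eight cases, those with two arguments equal to [x] contradict distinctness; four
   remain. *)
move=> /predU1P[->|us] /predU1P[->|vs] /predU1P[->|ts];
  rewrite ?eqxx ?andbF //= => /andP[/andP[uv ut] vt].
- exact: hx.
- by rewrite hC; apply: hx.
- by rewrite hAC hC; apply: hx.
- by apply: cs; rewrite //= !inE negb_or uv ut vt.
Qed.

Lemma h_uniq x y z : h x y z -> uniq [:: x; y; z].
Proof.
move=> hxyz; rewrite /= !inE negb_or !andbT; apply/andP; split; [apply/andP; split|];
  apply/eqP => e; move: hxyz; rewrite e ?hxx //; first by rewrite hAC hxx.
by rewrite hC hAC hxx.
Qed.

Lemma sum3_le_uniq r : uniq r ->
  sum3 h r r r <= size r * (size r - 1) * (size r - 2).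
Proof.
move=> Ur; rewrite -sum3_uniq //.
apply: leq_sum => x _; apply: leq_sum => y _; apply: leq_sum => z _.
case hxyz: (h x y z) => //; rewrite lt0b.
by rewrite -(rev_uniq [:: z; y; x]); apply: h_uniq.
Qed.

Definition has_clique k r :=
  exists s, [/\ size s = k, uniq s, {subset s <= r} & clique s].

(* Each side counts ordered 4-tuples: every edge extends in size r - 3 ways to
   four points, which span at most three edges.  The factor size r - 3 cannot be
   cancelled for size r = 3, where the inequality may fail. *)
Lemma clique4_free_sum3 r : uniq r -> ~ has_clique 4 r ->
  (size r - 3) * (4 * sum3 h r r r) <=
  (size r - 3) * (3 * (size r * (size r - 1) * (size r - 2))).
Proof.
move=> Ur nK.
(* The reversed order puts the innermost summation variable at the head, as [sum_uniq_cons]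
   expects. *)
pose d (x y z t : T) := uniq [:: t; z; y; x].
pose sum4 (F : T -> T -> T -> T -> nat) :=
  \sum_(x <- r) \sum_(y <- r) \sum_(z <- r) \sum_(t <- r) F x y z t.
have eq_sum4 F1 F2 : (forall x y z t, F1 x y z t = F2 x y z t) -> sum4 F1 = sum4 F2.
  move=> eqF; apply: eq_bigr => x _; apply: eq_bigr => y _.
  by apply: eq_bigr => z _; apply: eq_bigr => t _; apply: eqF.
have swap12 F : sum4 F = sum4 (fun x y z t => F y x z t) by apply: exchange_big.
have swap23 F : sum4 F = sum4 (fun x y z t => F x z y t).
  by apply: eq_bigr => x _; apply: exchange_big.
have swap34 F : sum4 F = sum4 (fun x y z t => F x y t z).
  by apply: eq_bigr => x _; apply: eq_bigr => y _; apply: exchange_big.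
have dC12 x y z t : d y x z t = d x y z t.
  by apply/perm_uniq/permP => p /=; lia.
have dC23 x y z t : d x z y t = d x y z t.
  by apply/perm_uniq/permP => p /=; lia.
have dC34 x y z t : d x y t z = d x y z t.
  by apply/perm_uniq/permP => p /=; lia.
have sum123 : sum4 (fun x y z t => d x y z t * h x y z) = (size r - 3) * sum3 h r r r.
  rewrite /sum4 /sum3 big_distrr /=; apply: eq_big_seq => x xr.
  rewrite big_distrr /=; apply: eq_big_seq => y yr.
  rewrite big_distrr /=; apply: eq_big_seq => z zr.
  rewrite -big_distrl /= [X in X * _](@sum_uniq_cons _ r [:: z; y; x] 3) //; last first.
    by apply/allP; rewrite /= xr yr zr.
  case hxyz: (h x y z); last by rewrite !muln0.
  by rewrite -(rev_uniq [:: z; y; x]) (h_uniq hxyz) muln1.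
(* The other three faces of a 4-tuple reduce to the first by transposing neighbouring summation
   variables. *)
have sum124 : sum4 (fun x y z t => d x y z t * h x y t) = (size r - 3) * sum3 h r r r.
  by rewrite -sum123 swap34; apply: eq_sum4 => x y z t; rewrite dC34.
have sum134 : sum4 (fun x y z t => d x y z t * h x z t) = (size r - 3) * sum3 h r r r.
  by rewrite -sum124 swap23; apply: eq_sum4 => x y z t; rewrite dC23.
have sum234 : sum4 (fun x y z t => d x y z t * h y z t) = (size r - 3) * sum3 h r r r.
  by rewrite -sum134 swap12; apply: eq_sum4 => x y z t; rewrite dC12.
have sumd : sum4 (fun x y z t => d x y z t * 3) =
    (size r - 3) * (3 * (size r * (size r - 1) * (size r - 2))).
  rewrite -sum3_uniq // /sum4 /sum3 !big_distrr /=; apply: eq_big_seq => x xr.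
  rewrite !big_distrr /=; apply: eq_big_seq => y yr.
  rewrite !big_distrr /=; apply: eq_big_seq => z zr.
  rewrite -big_distrl /= [X in X * _](@sum_uniq_cons _ r [:: z; y; x] 3) //; last first.
    by apply/allP; rewrite /= xr yr zr.
  by rewrite -mulnA (mulnC 3).
have sumD F1 F2 : sum4 (fun x y z t => F1 x y z t + F2 x y z t) = sum4 F1 + sum4 F2.
  rewrite /sum4 -big_split; apply: eq_bigr => x _; rewrite -big_split.
  apply: eq_bigr => y _; rewrite -big_split; apply: eq_bigr => z _.
  by rewrite -big_split.
have -> : (size r - 3) * (4 * sum3 h r r r) =
    sum4 (fun x y z t => d x y z t * h x y z + d x y z t * h x y t
                       + d x y z t * h x z t + d x y z t * h y z t).
  by rewrite !sumD sum123 sum124 sum134 sum234; lia.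
rewrite -sumd /sum4; rewrite big_seq [leqRHS]big_seq; apply: leq_sum => x xr.
rewrite big_seq [leqRHS]big_seq; apply: leq_sum => y yr.
rewrite big_seq [leqRHS]big_seq; apply: leq_sum => z zr.
rewrite big_seq [leqRHS]big_seq; apply: leq_sum => t tr.
case dxyzt: (d x y z t); rewrite // !mul1n.
suff : ~~ [&& h x y z, h x y t, h x z t & h y z t].
  by case: (h x y z); case: (h x y t); case: (h x z t); case: (h y z t).
apply/negP => /and4P[xyz xyt xzt yzt]; apply: nK.
exists [:: x; y; z; t]; split=> //.
- by rewrite -rev_uniq.
- by apply/allP; rewrite /= xr yr zr tr.
apply: clique_cons; last first.
  move=> u v; rewrite !inE => /or3P[]/eqP-> /or3P[]/eqP->; rewrite ?eqxx //.
  - by rewrite hAC.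
  - by rewrite hAC.
  - by rewrite hAC.
apply: clique_cons; last first.
  move=> u v; rewrite !inE => /orP[]/eqP-> /orP[]/eqP->; rewrite ?eqxx //.
  by rewrite hAC.
apply: clique_cons; last by move=> u v; rewrite !inE => /eqP-> /eqP->; rewrite eqxx.
by rewrite /clique /= !inE !eqxx.
Qed.

End CliqueFree.

(** * Removing a K_4 or a K_5 from an F_{3,3}-free 3-graph *)

Section F33Free.
Variables (T : eqType) (h : T -> T -> T -> bool).
Hypothesis hC : forall x y z, h x y z = h y x z.
Hypothesis hAC : forall x y z, h x y z = h x z y.
Hypothesis hxx : forall x y, h x x y = false.
Hypothesis h_free : forall a b c x y z, ~~ [&& h a b c,
  h a x y, h a x z, h a y z, h b x y, h b x z, h b y z,
  h c x y, h c x z & h c y z].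
Implicit Types (r s V : seq T).

(** Nine crossing edges together with the edge abc would form F_{3,3}, so at least one of the nine
    is missing. *)
Lemma F33_free_sum a b c x y z : h a b c ->
  (h a x y + h a x z + h a y z) + (h b x y + h b x z + h b y z)
  + (h c x y + h c x z + h c y z) <= 8.
Proof.
move=> habc; have := h_free a b c x y z; rewrite habc /=.
case: (h a x y) => //; case: (h a x z) => //; case: (h a y z) => //;
case: (h b x y) => //; case: (h b x z) => //; case: (h b y z) => //;
by case: (h c x y) => //; case: (h c x z) => //; case: (h c y z).
Qed.

Lemma hyy x y : h x y y = false.
Proof. by rewrite hC hAC hxx. Qed.

Lemma sum3_clique4 a b c d r :
    uniq [:: a; b; c; d] -> clique h [:: a; b; c; d] ->
  sum3 h [:: a; b; c; d] r r <=
  3 * (size r * (size r - 1)) + 2 * (size r)./2.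
Proof.
move=> Us /cliqueP cs; rewrite sum3E.
have : [&& h a b c, h a b d, h a c d & h b c d].
  move: Us; rewrite /= !inE !negb_or !andbT.
  move=> /and3P[/and3P[ab ac ad] /andP[bc bd] cd].
  by apply/and4P; split; apply: cs;
     rewrite /= !inE ?negb_or ?eqxx ?orbT ?ab ?ac ?ad ?bc ?bd ?cd.
case/and4P=> habc habd hacd hbcd.
apply: (@sum2_le _ (fun y z => \sum_(x <- [:: a; b; c; d]) h x y z)).
- by move=> y z; apply: eq_bigr => x _; rewrite hAC.
- by move=> y; apply: big1 => x _; rewrite hyy.
- move=> y z; rewrite !big_cons !big_nil.
  by case: (h a y z); case: (h b y z); case: (h c y z); case: (h d y z).
move=> x y z; rewrite !big_cons !big_nil.
(* Each point of the K_4 lies in three of its four triples. Adding the four inequalities gives 3 * W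
   <= 32 for the weight W of the triangle xyz, hence W <= 10. *)
have := F33_free_sum x y z habc; have := F33_free_sum x y z habd.
have := F33_free_sum x y z hacd; have := F33_free_sum x y z hbcd.
have le3 p : h p x y + h p x z + h p y z <= 3.
  by case: (h p x y); case: (h p x z); case: (h p y z).
move: (le3 a) (le3 b) (le3 c) (le3 d); clear.
do 12!(move: (nat_of_bool (h _ _ _)) => ?); lia.
Qed.

Lemma sum3_clique4_cat s r : size s = 4 -> uniq (s ++ r) -> clique h s ->
    ~ has_clique h 5 (s ++ r) ->
  sum3 h (s ++ r) (s ++ r) (s ++ r) <=
  24 + 30 * size r + 3 * (3 * (size r * (size r - 1)) + 2 * (size r)./2)
  + sum3 h r r r.
Proof.
move=> sz4; rewrite cat_uniq => /and3P[Us /hasPn rs Ur] cs nK5.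
have sss := sum3_le_uniq hC hAC hxx Us.
case: s sz4 Us cs rs nK5 sss => [|a [|c [|d [|e []]]]] // _ Us cs rs nK5 sss.
set s := [:: a; c; d; e] in rs nK5 sss *.
(* Ordered pairs count twice, so a vertex with more than 10 forms edges with all six pairs of [s]
   and extends [s] to a K_5. *)
have rss : sum3 h r s s <= 10 * size r.
  apply: leq_sum_size => z zr; rewrite leqNgt; apply/negP => gt10; apply: nK5.
  have : [&& h z a c, h z a d, h z a e, h z c d, h z c e & h z d e].
    move: gt10; rewrite !big_cons !big_nil !hyy.
    rewrite (hAC z c a) (hAC z d a) (hAC z e a) (hAC z d c) (hAC z e c) (hAC z e d).
    by case: (h z a c); case: (h z a d); case: (h z a e);
       case: (h z c d); case: (h z c e); case: (h z d e).
  case/and5P => zac zad zae zcd /andP[zce zde].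
  exists (z :: s); split=> //; first by rewrite /= (rs z zr).
  - by move=> x; rewrite in_cons mem_cat => /predU1P[->|->//]; rewrite zr orbT.
  apply: clique_cons => // x y; rewrite !inE.
  by move=> /or4P[]/eqP-> /or4P[]/eqP->; rewrite ?eqxx // hAC.
have srr := sum3_clique4 r Us cs.
rewrite sum3_cat; [|by move=> *; rewrite hC|by move=> *; rewrite hAC].
by move: sss srr rss; rewrite -/s -[size s]/4; lia.
Qed.

(** The factor 4 arises because each point of [s] lies in four of its five 4-subsets. In terms of
    [sum3_cat], 240 is 4 * 60 for the triples inside [s], 168 is 4 * 3 * 14 for the vertices with
    two points of [s], and 15 is 3 * 5 for the weights over the five 4-subsets. *)
Lemma sum3_clique5_cat s r : size s = 5 -> uniq (s ++ r) -> clique h s ->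
  4 * sum3 h (s ++ r) (s ++ r) (s ++ r) <=
  240 + 168 * size r + 15 * (3 * (size r * (size r - 1)) + 2 * (size r)./2)
  + 4 * sum3 h r r r.
Proof.
move=> sz5; rewrite cat_uniq => /and3P[Us _ _] cs.
have sss := sum3_le_uniq hC hAC hxx Us.
case: s sz5 Us cs sss => [|a [|c [|d [|e [|f []]]]]] // _ Us cs sss.
set s := [:: a; c; d; e; f] in sss *.
have cl4 x1 x2 x3 x4 : uniq [:: x1; x2; x3; x4] -> all (mem s) [:: x1; x2; x3; x4] ->
    sum3 h [:: x1; x2; x3; x4] r r <= 3 * (size r * (size r - 1)) + 2 * (size r)./2.
  move=> U4 /allP sub4; apply: sum3_clique4 => //; apply/cliqueP => x y z xs ys zs.
  by move/cliqueP: cs; apply; apply: sub4.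
have srr : 4 * sum3 h s r r <= 5 * (3 * (size r * (size r - 1)) + 2 * (size r)./2).
  have := cl4 a c d e; have := cl4 a c d f; have := cl4 a c e f.
  have := cl4 a d e f; have := cl4 c d e f.
  move: Us; rewrite /s /sum3 !big_cons !big_nil /= !inE !eqxx ?orbT !negb_or !andbT.
  case/and4P => /and4P[-> -> -> ->] /and3P[-> -> ->] /andP[-> ->] -> /=.
  do 5![move=> /(_ isT isT) ?].
  lia.
have rss : sum3 h r s s <= 14 * size r.
  apply: leq_sum_size => z zr.
  (* Otherwise {z, x1, x2} and {x3, x4, x5} span a copy of F_{3,3}.  Each pair of
     points of s occurs in four of these ten inequalities, whence the bound 7. *)
  have K23 x1 x2 x3 x4 x5 : perm_eq [:: x1; x2; x3; x4; x5] s ->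
      h z x1 x2 + (h z x3 x4 + h z x3 x5 + h z x4 x5) <= 3.
    move=> ps; have : uniq [:: x1; x2; x3; x4; x5] by rewrite (perm_uniq ps).
    have : all (mem s) [:: x1; x2; x3; x4; x5].
      by apply/allP => x; rewrite (perm_mem ps).
    move=> /and5P[s1 s2 s3 s4 /andP[s5 _]].
    rewrite /= !inE !negb_or !andbT.
    move=> /and4P[/and4P[_ n13 n14 n15] /and3P[n23 n24 n25] /andP[n34 n35] n45].
    case z12 : (h z x1 x2); last first.
      by case: (h z x3 x4); case: (h z x3 x5); case: (h z x4 x5).
    have : [&& h x1 x3 x4, h x1 x3 x5, h x1 x4 x5, h x2 x3 x4, h x2 x3 x5 & h x2 x4 x5].
      by move/cliqueP: cs => cs; rewrite !cs //= !inE;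
         rewrite ?negb_or ?n13 ?n14 ?n15 ?n23 ?n24 ?n25 ?n34 ?n35 ?n45.
    move: (F33_free_sum x3 x4 x5 z12) => /[swap].
    case/and5P=> -> -> -> -> /andP[-> ->]; clear.
    do 3!(move: (nat_of_bool (h _ _ _)) => ?); lia.
  rewrite !big_cons !big_nil !hyy.
  rewrite (hAC z c a) (hAC z d a) (hAC z e a) (hAC z d c) (hAC z e c) (hAC z e d).
  rewrite (hAC z f a) (hAC z f c) (hAC z f d) (hAC z f e).
  have [] : [/\ h z a c + (h z d e + h z d f + h z e f) <= 3,
                h z a d + (h z c e + h z c f + h z e f) <= 3,
                h z a e + (h z c d + h z c f + h z d f) <= 3,
                h z a f + (h z c d + h z c e + h z d e) <= 3
              & h z c d + (h z a e + h z a f + h z e f) <= 3].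
    by split; apply: K23; apply/permP => p; rewrite /s /=; clear;
       do 5!(move: (nat_of_bool (p _)) => ?); lia.
  have [] : [/\ h z c e + (h z a d + h z a f + h z d f) <= 3,
                h z c f + (h z a d + h z a e + h z d e) <= 3,
                h z d e + (h z a c + h z a f + h z c f) <= 3,
                h z d f + (h z a c + h z a e + h z c e) <= 3
              & h z e f + (h z a c + h z a d + h z c d) <= 3].
    by split; apply: K23; apply/permP => p; rewrite /s /=; clear;
       do 5!(move: (nat_of_bool (p _)) => ?); lia.
  clear; do 10!(move: (nat_of_bool (h _ _ _)) => ?); lia.
rewrite sum3_cat; [|by move=> *; rewrite hC|by move=> *; rewrite hAC].
by move: sss srr rss; rewrite -/s -[size s]/5; lia.
Qed.

Lemma perm_cat_filter s V : uniq s -> uniq V -> {subset s <= V} ->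
  perm_eq V (s ++ [seq x <- V | x \notin s]).
Proof.
move=> Us UV sV; apply: uniq_perm => //.
  rewrite cat_uniq Us filter_uniq // andbT.
  by apply/hasPn => x; rewrite mem_filter => /andP[].
move=> x; rewrite mem_cat mem_filter; case: (boolP (x \in s)) => //= /sV -> //.
Qed.

Lemma has_cliqueS k V W :
  {subset V <= W} -> has_clique h k V -> has_clique h k W.
Proof. by move=> VW [s [? ? sV ?]]; exists s; split=> // x /sV/VW. Qed.

Lemma sum3_clique5_free V : uniq V -> ~ has_clique h 5 V ->
  sum3 h V V V <= 6 * b (size V).
Proof.
have [n] := ubnP (size V); elim: n V => // n IH V lt_V UV nK5.
(* Assuming that the bound fails lets a clique be refuted by proving the bound, without deciding
   whether a clique exists. *)
apply: contraT => nle; have nK4 : ~ has_clique h 4 V.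
  case=> s [sz4 Us sV cs]; case/negP: nle.
  have eqV := perm_cat_filter Us UV sV.
  move: [seq x <- V | _] eqV => r eqV.
  have szV : size V = size r + 4 by rewrite (perm_size eqV) size_cat sz4 addnC.
  have UV' : uniq (s ++ r) by rewrite -(perm_uniq eqV).
  have sub_r : {subset r <= V} by move=> x xr; rewrite (perm_mem eqV) mem_cat xr orbT.
  have nK5' : ~ has_clique h 5 (s ++ r).
    by move=> K; apply/nK5/(has_cliqueS _ K) => x; rewrite (perm_mem eqV).
  have {}IH : sum3 h r r r <= 6 * b (size r).
    apply: IH; [by lia | by move: UV'; rewrite cat_uniq => /and3P[] |].
    by move/(has_cliqueS sub_r).
  rewrite (perm_sum3 _ eqV) szV -b_add4.
  by apply: leq_trans (sum3_clique4_cat sz4 UV' cs nK5') _; rewrite leq_add2l.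
(* Up to three vertices, b(n) = C(n, 3) and the trivial bound suffices; beyond that the factor
   [size V - 3] is positive and cancels. *)
case/negP: nle; have [V3|V4] := leqP (size V) 3.
  apply: leq_trans (sum3_le_uniq hC hAC hxx UV) _.
  by case: (size V) V3 => [|[|[|[|]]]].
have := clique4_free_sum3 hC hAC hxx UV nK4.
have := b_ge_three_quarters V4; rewrite leq_pmul2l ?subn_gt0 //; lia.
Qed.

(** The extra 6 is the single edge by which K_5, with ten edges, exceeds b(5) = 9. It may recur in
    the induction hypothesis, when five vertices remain, and [b_add5_ge] accounts for that. *)
Lemma sum3_le V : uniq V ->
  sum3 h V V V <= 6 * b (size V) + 6 * (size V == 5).
Proof.
have [n] := ubnP (size V); elim: n V => // n IH V lt_V UV.
apply: contraT => nle; have nK5 : ~ has_clique h 5 V.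
  case=> s [sz5 Us sV cs]; case/negP: nle.
  have eqV := perm_cat_filter Us UV sV.
  move: [seq x <- V | _] eqV => r eqV.
  have szV : size V = size r + 5 by rewrite (perm_size eqV) size_cat sz5 addnC.
  have UV' : uniq (s ++ r) by rewrite -(perm_uniq eqV).
  have Ur : uniq r by move: UV'; rewrite cat_uniq => /and3P[].
  have {}IH := IH r ltac:(lia) Ur.
  rewrite -(leq_pmul2l (isT : 0 < 4)) (perm_sum3 _ eqV) szV.
  apply: leq_trans (sum3_clique5_cat sz5 UV' cs) (leq_trans _ (b_add5_ge _)).
  by rewrite leq_add2l leq_pmul2l.
by case/negP: nle; apply: leq_trans (sum3_clique5_free UV nK5) (leq_addr _ _).
Qed.

End F33Free.

(** * 3-graphs as edge sets *)

Lemma in_abc u : (u \in abc) = if u is inl _ then true else false.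
Proof. by case: u => i; [rewrite imset_f | apply/imsetP => -[]]. Qed.

Lemma in_xyz u : (u \in xyz) = if u is inl _ then false else true.
Proof. by case: u => i; [apply/imsetP => -[] | rewrite imset_f]. Qed.

Section Hypergraphs.
Variables (T : finType) (G : {set {set T}}).
Hypothesis G3 : is_3graph G.

Definition edge x y z := [set x; y; z] \in G.

Lemma edgeC x y z : edge x y z = edge y x z.
Proof. by rewrite /edge [[set x; y]]setUC. Qed.

Lemma edgeAC x y z : edge x y z = edge x z y.
Proof. by rewrite /edge setUAC. Qed.

Lemma card_edge e : e \in G -> #|e| = 3.
Proof. by move=> eG; apply/eqP; apply: (forall_inP G3). Qed.

Lemma edgexx x y : edge x x y = false.
Proof.
apply/negP => /card_edge; rewrite setUid.
by rewrite cards2; case: (x != y).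
Qed.

(** Injectivity of the vertex map comes for free. The first edge has three elements, so [p] is
    injective, and an edge on [p i], [q j], [q k] keeps these three vertices distinct. *)
Lemma F33_copyP : contains_copy F33 G <->
  exists p q : 'I_3 -> T, [set p i | i : 'I_3] \in G /\
    forall i j k, j != k -> edge (p i) (q j) (q k).
Proof.
split=> [/existsP[f /andP[/injectiveP f_inj /forall_inP fF]]|[p [q [pG pqG]]]].
  exists (f \o inl), (f \o inr); split=> [|i j k jk].
    rewrite (_ : [set _ | i : 'I_3] = f @: abc); last by rewrite -imset_comp; apply: eq_imset.
    by apply: fF; rewrite !inE eqxx.
  have := fF [set inl i; inr j; inr k]; rewrite !imsetU !imset_set1; apply.
  rewrite !inE; apply/orP; right.
  have -> : [set inl i; inr j; inr k] :&: abc = [set inl i].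
    by apply/setP => -[u|u]; rewrite !inE in_abc ?andbT ?andbF ?orbF.
  have -> : [set inl i; inr j; inr k] :&: xyz = [set inr j; inr k].
    by apply/setP => -[u|u]; rewrite !inE in_xyz ?andbT ?andbF.
  by rewrite cards1 cards2 /= (inj_eq (@inr_inj _ _)) jk.
have p_inj : injective p.
  have /imset_injP pI : #|[set p i | i : 'I_3]| == #|'I_3|.
    by rewrite (card_edge pG) card_ord.
  by move=> i j; apply: pI.
apply/existsP; exists [ffun u => match u with inl i => p i | inr j => q j end].
(* Any index other than [j] completes [p i] and [q j] to an edge. *)
have pq i j : p i != q j.
  have [k jk] : exists k : 'I_3, j != k.
    by have [->|j0] := eqVneq j ord0; [exists ord_max | exists ord0].
  apply: contraTneq (pqG i _ _ jk) => ->; by rewrite edgexx.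
apply/andP; split.
  apply/injectiveP => -[i|i] [j|j]; rewrite !ffunE.
  - by move/p_inj->.
  - by move/eqP; rewrite (negbTE (pq _ _)).
  - by move/esym/eqP; rewrite (negbTE (pq _ _)).
  - apply: contra_eq => ij. 
    apply: contraTneq (pqG ord0 i j _) => [->|]; last by apply: contra_neq ij => ->.
    by rewrite edgeC edgeAC edgexx.
apply/forall_inP => e; rewrite !inE => /predU1P[->|/andP[/cards1P[u eu]]].
  rewrite -imset_comp (eq_imset (g := p)) // => i; by rewrite /= ffunE.
case/cards2P=> v [w [vw evw]].
have : u \in abc by have := set11 u; rewrite -eu inE => /andP[].
have : v \in xyz by have := set21 v w; rewrite -evw inE => /andP[].
have : w \in xyz by have := set22 v w; rewrite -evw inE => /andP[].
case/imsetP=> k _ ?; case/imsetP=> j _ ?; case/imsetP=> i _ ?; subst u v w.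
have -> : e = [set inl i; inr j; inr k].
  rewrite -setUA -eu -evw -setIUr; apply/esym/setIidPl/subsetP => -[t|t] _.
    by rewrite inE imset_f.
  by rewrite inE orbC imset_f.
rewrite !imsetU !imset_set1 !ffunE; apply: pqG.
by apply: contra_neq vw => ->.
Qed.

Lemma F33_free_edge : free F33 G -> forall a c d x y z,
  ~~ [&& edge a c d, edge a x y, edge a x z, edge a y z, edge c x y,
      edge c x z, edge c y z, edge d x y, edge d x z & edge d y z].
Proof.
move=> freeG a c d x y z; apply: contra freeG.
case/and5P => acd axy axz ayz /and5P[cxy cxz cyz dxy /andP[dxz dyz]].
apply/F33_copyP; exists (tnth [tuple a; c; d]), (tnth [tuple x; y; z]); split.
  suff -> : [set tnth [tuple a; c; d] i | i : 'I_3] = [set a; c; d] by [].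
  apply/setP => u; rewrite !inE -orbA.
  apply/imsetP/idP => [[i _ ->]|].
    by have := mem_tnth i [tuple a; c; d]; rewrite !inE.
  rewrite orbA => uacd; have /tnthP[i ->] : u \in [tuple a; c; d] by rewrite !inE orbA.
  by exists i.
move=> i j k; rewrite !(tnth_nth a).
by case: i j k => [[|[|[|]]] //= ?] [[|[|[|]]] //= ?] [[|[|[|]]] //= ?] // _;
   rewrite // edgeAC.
Qed.

(** Ordered triples are grouped by their underlying set; the fibre over an edge contains its six
    orderings. *)
Lemma card_edges_le_sum3 : 6 * #|G| <= sum3 edge (enum T) (enum T) (enum T).
Proof.
have -> : sum3 edge (enum T) (enum T) (enum T) =
    \sum_(p : T * T * T) edge p.1.1 p.1.2 p.2.
  rewrite /sum3 big_enum /= -(pair_bigA _ (fun p z => edge p.1 p.2 z : nat)) /=.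
  rewrite -(pair_bigA _ (fun x y => \sum_z (edge x y z : nat))) /=.
  by apply: eq_bigr => x _; rewrite big_enum; apply: eq_bigr => y _; rewrite big_enum.
pose triple (p : T * T * T) := [set p.1.1; p.1.2; p.2].
rewrite (eq_bigr (fun p => if triple p \in G then 1 else 0)); last first.
  by move=> p _; rewrite /edge -/(triple p); case: (triple p \in G).
rewrite -big_mkcond /= (partition_big triple (mem G)) //= mulnC -sum_nat_const.
apply: leq_sum => e eG; have := card_edge eG; rewrite cardE.
case eq_e : (enum e) => [|a [|c [|d [|]]]] // _.
have := enum_uniq e; rewrite eq_e /= !inE negb_or !andbT => /andP[/andP[ac ad] cd].
have e_acd : e = [set a; c; d].
  by apply/setP => u; rewrite -mem_enum eq_e !inE orbA.
rewrite sum1_card.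
pose s6 := [:: (a, c, d); (a, d, c); (c, a, d); (c, d, a); (d, a, c); (d, c, a)].
have U6 : uniq s6.
  rewrite /= !inE !xpair_eqE /= !(eq_sym c a) !(eq_sym d a) !(eq_sym d c).
  by rewrite (negbTE ac) (negbTE ad) (negbTE cd) !eqxx.
rewrite -[6]/(size s6) -(card_uniqP U6); apply/subset_leq_card/subsetP => p.
move=> p6; suff : triple p = e by rewrite unfold_in /= => ->; rewrite eG eqxx.
move: p6; rewrite !inE e_acd => p6; case/or4P: p6 => [||| /or3P[]] /eqP-> ; rewrite /triple /=.
all: apply/setP => u; rewrite !inE.
all: by case: (u == a); case: (u == c); case: (u == d).
Qed.

End Hypergraphs.

Lemma F33_free_card_le n (G : {set {set 'I_n}}) :
  is_3graph G -> free F33 G -> #|G| <= b n + (n == 5).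
Proof.
move=> G3 freeG; rewrite -(leq_pmul2l (isT : 0 < 6)).
apply: leq_trans (card_edges_le_sum3 G3) _.
have := sum3_le (edgeC G) (edgeAC G) (edgexx G3) (F33_free_edge G3 freeG) (enum_uniq 'I_n).
by rewrite size_enum_ord mulnDr.
Qed.

(** * The lower bound: triples meeting both halves, and the complete 3-graph on five vertices *)

Definition bipartite_triples (T : finType) (A : {set T}) : {set {set T}} :=
  [set e : {set T} | [&& #|e| == 3, ~~ (e \subset A) & ~~ (e \subset ~: A)]].

Lemma bipartite_triples_3graph (T : finType) (A : {set T}) :
  is_3graph (bipartite_triples A).
Proof. by apply/forall_inP => e; rewrite inE => /and3P[]. Qed.

(** By pigeonhole two of x, y, z lie on the same side. Their edges with a, b and c force all three
    of these to the other side, so the edge abc would not meet both sides. *)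
Lemma bipartite_triples_free (T : finType) (A : {set T}) :
  free F33 (bipartite_triples A).
Proof.
apply/negP => /(F33_copyP (bipartite_triples_3graph A))[p [q [pG pqG]]].
have [j [k [jk qjk]]] : exists j k, j != k /\ (q j \in A) = (q k \in A).
  pose o1 : 'I_3 := Ordinal (isT : 1 < 3).
  case E0 : (q ord0 \in A); case E1 : (q o1 \in A); case E2 : (q ord_max \in A);
  solve [by exists ord0, o1; rewrite E0 E1 | by exists ord0, ord_max; rewrite E0 E2
        | by exists o1, ord_max; rewrite E1 E2].
have no_mono B : B = A \/ B = ~: A -> q j \in B -> q k \in B ->
    forall i, p i \notin B.
  move=> AB qj qk i; apply/negP => pi.
  have sub : [set p i; q j; q k] \subset B.
    by apply/subsetP => u; rewrite !inE => /orP[/orP[]|] /eqP->.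
  have := pqG i j k jk; rewrite /edge inE.
  by case: AB => <-; rewrite sub ?andbF.
move: pG; rewrite inE => /and3P[_ /subsetPn pA /subsetPn pAC].
case qjA : (q j \in A).
  case: pAC => _ /imsetP[i _ ->]; rewrite inE negbK; apply/negP.
  by apply: no_mono; [left | | rewrite -qjk].
case: pA => _ /imsetP[i _ ->] piA; have := no_mono (~: A) (or_intror erefl).
by rewrite !inE -qjk qjA => /(_ isT isT i); rewrite inE piA.
Qed.

Lemma card_bipartite_triples (T : finType) (A : {set T}) :
  #|bipartite_triples A| = 'C(#|T|, 3) - 'C(#|A|, 3) - 'C(#|~: A|, 3).
Proof.
have -> : bipartite_triples A =
  [set e : {set T} | #|e| == 3] :\: [set e : {set T} | e \subset A & #|e| == 3]
   :\: [set e : {set T} | e \subset ~: A & #|e| == 3].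
  apply/setP => e; rewrite !inE.
  by case: (#|e| == 3); case: (e \subset A); case: (e \subset ~: A).
rewrite -card_draws -!cards_draws !cardsD; congr (_ - _ - _).
  by apply: eq_card => e; rewrite !inE; case: (#|e| == 3); rewrite ?andbF.
(* A triple inside the complement of [A] is not inside [A], being nonempty, so the second
   subtraction removes the whole family of such triples. *)
apply: eq_card => e; rewrite !inE; case: (boolP (#|e| == 3)) => [e3|]; rewrite ?andbF //= !andbT.
apply/andb_idl => eAC; apply/negP => eA.
have : e \subset A :&: ~: A by rewrite subsetI eA.
by rewrite setICr subset0 -cards_eq0 (eqP e3).
Qed.

Lemma ex_F33_ge n : b n <= ex n F33.
Proof.
pose A : {set 'I_n} := [set i : 'I_n | i < n./2].
have cardA : #|A| = n./2.
  rewrite cardsE -sum1_card big_mkcond /=.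
  rewrite -(big_mkord xpredT (fun i => if i < n./2 then 1 else 0)) -big_mkcond.
  by rewrite -(big_nat_widen 0 n./2 n xpredT (fun=> 1)) ?sum_nat_const_nat ?subn0 ?muln1 //; lia.
have cardAC : #|~: A| = uphalf n by rewrite cardsCs setCK cardA card_ord; lia.
rewrite /b -{1}[n]card_ord -cardA -cardAC -card_bipartite_triples.
apply: (bigmax_sup (bipartite_triples A)) => //.
by rewrite bipartite_triples_3graph bipartite_triples_free.
Qed.

(** F_{3,3} has six vertices, so the complete 3-graph on five vertices is free of it. *)
Lemma ex_5_F33_ge : 10 <= ex 5 F33.
Proof.
rewrite (_ : 10 = #|[set e : {set 'I_5} | #|e| == 3]|); last by rewrite card_draws card_ord.
apply: (bigmax_sup [set e : {set 'I_5} | #|e| == 3]) => //; apply/andP; split.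
  by apply/forall_inP => e; rewrite inE.
apply/negP => /existsP[f /andP[/injectiveP /leq_card]].
by rewrite card_sum !card_ord.
Qed.

Theorem theorem1p1 :
  (forall n : nat, 1 <= n -> n <> 5 -> ex n F33 = b n) /\ ex 5 F33 = 10.
Proof.
have ex_le n : ex n F33 <= b n + (n == 5).
  by apply/bigmax_leqP => G /andP[G3 freeG]; apply: F33_free_card_le.
split=> [n _ /eqP/negbTE n5|]; apply/eqP; rewrite eqn_leq.
  by rewrite ex_F33_ge andbT; have := ex_le n; rewrite n5 addn0.
by rewrite ex_5_F33_ge andbT; apply: leq_trans (ex_le 5) _.
Qed.
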